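(* The algorithm described in the context for the minimax problem of minimizing $Z(x)=x_1\vee\cdots\vee x_n$ over $x\in S(A,b)$, with $A$ an $m\times n$ matrix, terminates after $O(n^3)$ or $O(m^3)$ operations, i.e. after $O(\max\{m,n\}^3)$ operations.
   Context: Let $I=\{1,\dots,m\}$, $J=\{1,\dots,n\}$, $A=(a_{ij})_{m\times n}$ with $a_{ij}\in[0,1]$, and $b=(b_1,\dots,b_m)$ with $b_i>0$ real. The Łukasiewicz t-norm is $T_L(a,x)=\max\{a+x-1,0\}$ on $[0,1]^2$, and $S(A,b)=\{x\in[0,1]^n : \sum_{j\in J}T_L(a_{ij},x_j)\ge b_i \text{ for all } i\in I\}$. For $i\in I$, $S^i(A,b)=\{(y,\dots,y)\in[0,1]^n : \sum_{j\in J}T_L(a_{ij},y)\ge b_i\}$. The symbol $\vee$ denotes maximum. Subroutine for fixed $i\in I$ (for minimizing $y$ subject to $\sum_{j\in J}T_L(a_{ij},y)\ge b_i$, $y\in[0,1]$), with $J(\mathbf u)=\{j\in J : u\ge 1-a_{ij}\}$ for $\mathbf u=(u,\dots,u)$: (1) if $S^i(A,b)=\emptyset$, stop; (2) set $u^0=\frac{b_i-\sum_{j\in J}a_{ij}}{n}+1$, $\mathbf u^0=(u^0,\dots,u^0)$, $k:=0$; (3) compute $J(\mathbf u^k)$; if $\sum_{j\in J(\mathbf u^k)}T_L(a_{ij},u^k)=b_i$, go to (6); (4) set $k:=k+1$, $u^k=\frac{b_i-\sum_{j\in J(\mathbf u^{k-1})}a_{ij}}{|J(\mathbf u^{k-1})|}+1$,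 $\mathbf u^k=(u^k,\dots,u^k)$; (5) compute $J(\mathbf u^k)$; if $J(\mathbf u^k)\subsetneq J(\mathbf u^{k-1})$, go to (4); (6) output $\mathbf u^k$. Algorithm (input $A,b$; output $\mathbf u^*$). Step 1: check whether $S(A,b)=\emptyset$; if so, stop. Steps 2–3: replace the minimax problem by minimizing $y\in[0,1]$ subject to $\sum_{j\in J}T_L(a_{ij},y)\ge b_i$ for all $i\in I$, and decompose the latter into the $m$ single-constraint problems (one for each $i\in I$). Step 4: for every $i\in I$ compute the optimal solution $\mathbf u^{i*}=(u^{i*},\dots,u^{i*})$ of the $i$-th single-constraint problem by the subroutine. Step 5: compute $u^*=\bigvee_{i\in I}u^{i*}$ and $\mathbf u^*=(u^*,\dots,u^* )$. Step 6: output $\mathbf u^*$. Operations are elementary operations on real numbers (arithmetic operations and comparisons). *)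

(* Defs.v *)
From HB Require Import structures.
From mathcomp Require Import all_boot all_order all_algebra.
From mathcomp Require Import boolp classical_sets reals.

Set Implicit Arguments.
Unset Strict Implicit.
Unset Printing Implicit Defensive.

Import Order.TTheory GRing.Theory Num.Theory.

(** * Programs over real numbers

    In [prog V T], [V] is the type of the numbers handled by the program.  The
    programs below are polymorphic in [V], so they cannot compute with numbers
    except through [Arith] and [Cmp], which are the operations being counted.
    [Iter] is an unbounded loop: it may diverge. *)

Inductive arith_op := OpAdd | OpSub | OpMul | OpDiv.
Inductive cmp_op := CmpLe | CmpLt | CmpEq.

Inductive prog (V : Type) : Type -> Type :=
| Ret T : T -> prog V T
| Zero : prog V V
| One : prog V V
| Arith : arith_op -> V -> V -> prog V V
| Cmp : cmp_op -> V -> V -> prog V bool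
| Bind S T : prog V S -> (S -> prog V T) -> prog V T
| Iter S T : (S -> prog V (S + T)) -> S -> prog V T.

Arguments Ret {V T}.
Arguments Zero {V}.
Arguments One {V}.

Notation "'let*' x := p 'in' q" := (Bind p (fun x => q))
  (at level 200, x name, p at level 100, q at level 200,
   format "'[v' 'let*'  x  :=  p  'in' '/' q ']'").

(** ** Semantics and operation count *)

Section Semantics.
Variable R : realType.
Local Open Scope ring_scope.

Definition arith_val (o : arith_op) (x y : R) : R :=
  match o with
  | OpAdd => x + y
  | OpSub => x - y
  | OpMul => x * y
  | OpDiv => x / y
  end.

(* Division by zero is an error: a program that attempts it has no run. *)
Definition arith_def (o : arith_op) (y : R) : bool :=
  if o is OpDiv then y != 0 else true.

Definition cmp_val (o : cmp_op) (x y : R) : bool :=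
  match o with
  | CmpLe => x <= y
  | CmpLt => x < y
  | CmpEq => x == y
  end.

Inductive iter_run (S T : Type) (step : S -> nat -> S + T -> Prop) :
  S -> nat -> T -> Prop :=
| IterStop s c r : step s c (inr r) -> iter_run step s c r
| IterNext s s' c c' r :
    step s c (inl s') -> iter_run step s' c' r -> iter_run step s (c + c')%N r.

(* [run p c r]: [p] terminates with result [r] after exactly [c] arithmetic
   operations and comparisons. *)
Fixpoint run (T : Type) (p : prog R T) : nat -> T -> Prop :=
  match p in prog _ T return nat -> T -> Prop with
  | Ret _ t => fun c r => c = 0%N /\ r = t
  | Zero => fun c r => c = 0%N /\ r = 0
  | One => fun c r => c = 0%N /\ r = 1
  | Arith o x y => fun c r => [/\ arith_def o y, c = 1%N & r = arith_val o x y]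
  | Cmp o x y => fun c r => c = 1%N /\ r = cmp_val o x y
  | Bind _ _ q k => fun c r => exists c1 c2 s,
      [/\ run q c1 s, run (k s) c2 r & c = (c1 + c2)%N]
  | Iter _ _ body s => iter_run (fun s' => run (body s')) s
  end.

Lemma run_inj T (p : prog R T) c1 r1 c2 r2 :
  run p c1 r1 -> run p c2 r2 -> c1 = c2 /\ r1 = r2.
Proof.
elim: p c1 r1 c2 r2 => {T} [T t|||o x y|o x y|S T q IHq k IHk|S T body IHb s]
  c1 r1 c2 r2 /=; try by move=> [-> ->] [-> ->].
- by move=> [_ -> ->] [_ -> ->].
- move=> [d1 [e1 [s1 [q1 k1 ->]]]] [d2 [e2 [s2 [q2 k2 ->]]]].
  have [ed es] := IHq _ _ _ _ q1 q2; subst d2 s2.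
  by have [-> ->] := IHk _ _ _ _ _ k1 k2.
- move=> h1; elim: h1 c2 r2 => {s c1 r1} [s c r b1|s s' c c' r b1 _ IH] c2 r2 h2.
  + case: h2 b1 => [s0 d t b2 b1|s0 s' d d' t b2 _ b1].
      by have [-> [->]] := IHb _ _ _ _ _ b1 b2.
    by have [_] := IHb _ _ _ _ _ b1 b2.
  + case: h2 b1 IH => [s0 d t b2 b1 _|s0 s1 d d' t b2 h b1 IH].
      by have [_] := IHb _ _ _ _ _ b1 b2.
    have [-> [es]] := IHb _ _ _ _ _ b1 b2; subst s1.
    by have [-> ->] := IH _ _ h.
Qed.

End Semantics.

(** * The algorithm *)

Section Algorithm.
Variable V : Type.

Definition pmax (x y : V) : prog V V :=
  let* c := Cmp CmpLe x y in Ret (if c then y else x).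

Fixpoint psum (I : Type) (f : I -> prog V V) (s : seq I) : prog V V :=
  if s is i :: s' then
    let* x := f i in
    let* y := psum f s' in
    Arith OpAdd x y
  else Zero.

Fixpoint pall (I : Type) (f : I -> prog V bool) (s : seq I) : prog V bool :=
  if s is i :: s' then
    let* x := f i in
    let* y := pall f s' in
    Ret (x && y)
  else Ret true.

Fixpoint pfilter (I : Type) (f : I -> prog V bool) (s : seq I) :
    prog V (seq I) :=
  if s is i :: s' then
    let* x := f i in
    let* t := pfilter f s' in
    Ret (if x then i :: t else t)
  else Ret [::].

(* Stops at the first call that answers [None]. *)
Fixpoint pmapo (I T : Type) (f : I -> prog V (option T)) (s : seq I) :
    prog V (option (seq T)) :=
  if s is i :: s' then
    let* x := f i in
    if x is Some x' then
      let* t := pmapo f s' in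
      Ret (omap (cons x') t)
    else Ret None
  else Ret (Some [::]).

Definition pluk (a x : V) : prog V V :=
  let* s := Arith OpAdd a x in
  let* one := One in
  let* t := Arith OpSub s one in
  let* zero := Zero in
  pmax t zero.

Section Row.
Variables (n : nat) (a : 'I_n -> V) (b : V).

Definition psumluk (J : {set 'I_n}) (u : V) : prog V V :=
  psum (fun j => pluk (a j) u) (enum J).

(* Emptiness of the feasible set of one constraint is decided at [y = 1], the
   largest point of [0, 1]; see [prow_feasibleP]. *)
Definition prow_feasible : prog V bool :=
  let* one := One in
  let* s := psumluk [set: 'I_n] one in
  Cmp CmpLe b s.

Definition pJ (u : V) : prog V {set 'I_n} :=
  let* s := pfilter (fun j =>
      let* one := One in
      let* t := Arith OpSub one (a j) in
      Cmp CmpLe t u) (enum 'I_n) in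
  Ret [set j in s].

(* (b - \sum_(j in J) a_j) / |J| + 1, where |J| is obtained by counting. *)
Definition pnext (J : {set 'I_n}) : prog V V :=
  let* s := psum (fun j => Ret (a j)) (enum J) in
  let* d := Arith OpSub b s in
  let* k := psum (fun _ => One) (enum J) in
  let* q := Arith OpDiv d k in
  let* one := One in
  Arith OpAdd q one.

Definition pindic (J : {set 'I_n}) (j : 'I_n) : prog V V :=
  if j \in J then One else Zero.

Definition psubset (J K : {set 'I_n}) : prog V bool :=
  pall (fun j =>
      let* x := pindic J j in
      let* y := pindic K j in
      Cmp CmpLe x y) (enum 'I_n).

(* Index sets are compared through their 0/1 indicator vectors, so that this
   test is charged too. *)
Definition pproper (J K : {set 'I_n}) : prog V bool :=
  let* s := psubset J K in
  let* t := psubset K J in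
  Ret (s && ~~ t).

Definition subroutine : prog V (option V) :=
  let* ok := prow_feasible in
  if ~~ ok then Ret None else
  let* u0 := pnext [set: 'I_n] in
  let* J0 := pJ u0 in
  let* s := psumluk J0 u0 in
  let* opt := Cmp CmpEq s b in
  if opt then Ret (Some u0) else
  let* u := Iter (fun J =>
      let* u' := pnext J in
      let* J' := pJ u' in
      let* again := pproper J' J in
      Ret (if again then inl J' else inr u')) J0 in
  Ret (Some u).

End Row.

Definition pfeasible (m n : nat) (A : 'M[V]_(m, n)) (b : 'rV[V]_m) :
    prog V bool :=
  pall (fun i => prow_feasible (A i) (b ord0 i)) (enum 'I_m).

Fixpoint pmaxs (x : V) (s : seq V) : prog V V :=
  if s is y :: s' then
    let* z := pmax x y in
    pmaxs z s'
  else Ret x.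

(* [None]: the algorithm stops without output. *)
Definition algorithm (m n : nat) (A : 'M[V]_(m, n)) (b : 'rV[V]_m) :
    prog V (option 'rV[V]_n) :=
  let* ok := pfeasible A b in
  if ~~ ok then Ret None else
  let* us := pmapo (fun i => subroutine (A i) (b ord0 i)) (enum 'I_m) in
  if us is Some (u1 :: us') then
    let* u := pmaxs u1 us' in
    Ret (Some (const_mx u))
  else Ret None.

End Algorithm.

(** * The feasible sets, and correctness of the emptiness tests *)

Section Feasible.
Variable R : realType.
Local Open Scope ring_scope.
Local Open Scope classical_set_scope.

Definition luk (a x : R) : R := Num.max (a + x - 1) 0.

Definition unit_cube (n : nat) : set 'rV[R]_n :=
  [set x | forall j, 0 <= x ord0 j <= 1].

Definition feasible (m n : nat) (A : 'M[R]_(m, n)) (b : 'rV[R]_m) :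
    set 'rV[R]_n :=
  [set x | unit_cube x /\
           forall i, b ord0 i <= \sum_(j < n) luk (A i j) (x ord0 j)].

Definition feasible_row (n : nat) (a : 'I_n -> R) (b : R) : set 'rV[R]_n :=
  [set x | exists y, [/\ x = const_mx y, 0 <= y <= 1 &
                         b <= \sum_(j < n) luk (a j) y]].

Lemma run_psum I (f : I -> prog R R) (g : I -> R) (s : seq I) c r :
  (forall i c r, run (f i) c r -> r = g i) ->
  run (psum f s) c r -> r = \sum_(i <- s) g i.
Proof.
move=> fg; elim: s c r => [|i s IH] c r /=.
  by move=> [_ ->]; rewrite big_nil.
move=> [c1 [c2 [x [/fg -> [c3 [c4 [y [/IH -> [_ _ ->] _]]]] _]]]].
by rewrite big_cons.
Qed.

Lemma run_pall I (f : I -> prog R bool) (P : I -> Prop) (s : seq I) c r :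
  (forall i c r, run (f i) c r -> r <-> P i) ->
  run (pall f s) c r -> r <-> (forall k : 'I_(size s), P (tnth (in_tuple s) k)).
Proof.
move=> fP; elim: s c r => [|i s IH] c r /=.
  by move=> [_ ->]; split => // _ [].
move=> [c1 [c2 [x [/fP Hx [c3 [c4 [y [/IH Hy [_ ->] _]]]] _]]]]; split.
  move=> /andP[/Hx Pi /Hy Ps]; case=> [[|k] Hk]; rewrite (tnth_nth i) //=.
  by have := Ps (Ordinal (Hk : (k < size s)%N)); rewrite (tnth_nth i).
move=> Pall; apply/andP; split.
  by apply/Hx; have := Pall ord0; rewrite (tnth_nth i).
by apply/Hy => k; have := Pall (lift ord0 k); rewrite !(tnth_nth i).
Qed.

Lemma run_pluk a x c r : run (pluk a x) c r -> r = luk a x.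
Proof.
move=> /= [? [? [? [[_ _ ->] [? [? [? [[_ ->] [? [? [? [[_ _ ->]]]]]]]]]]]]].
move=> [? [? [? [[_ ->] [? [? [? [[_ ->] [_ ->] _]]]] _]]]] _ _ _.
by rewrite /luk; case: leP.
Qed.

Lemma run_prow_feasible n (a : 'I_n -> R) b c r :
  run (prow_feasible a b) c r -> r = (b <= \sum_(j < n) luk (a j) 1).
Proof.
move=> /= [? [? [? [[_ ->] [? [? [? [h [_ ->] _]]]] _]]]].
rewrite (run_psum (g := fun j => luk (a j) 1) _ h).
  by rewrite big_enum /=; congr (_ <= _); apply: eq_bigl => j; rewrite inE.
by move=> j c' r' /run_pluk.
Qed.

Lemma luk_le1 a x : x <= 1 -> luk a x <= luk a 1.
Proof. by move=> x1; rewrite /luk ge_max !le_max lexx orbT andbT lerD2r lerD2l x1. Qed.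

Lemma prow_feasibleP n (a : 'I_n -> R) b c r :
  run (prow_feasible a b) c r -> r <-> feasible_row a b !=set0.
Proof.
move=> /run_prow_feasible ->; split.
  by move=> h; exists (const_mx 1), 1; rewrite ler01 lexx.
move=> [_ [y [_ /andP[_ y1] h]]]; apply: (le_trans h).
by apply: ler_sum => j _; exact: luk_le1.
Qed.

Lemma pfeasibleP m n (A : 'M[R]_(m, n)) b c r :
  run (pfeasible A b) c r -> r <-> feasible A b !=set0.
Proof.
pose P i := b ord0 i <= \sum_(j < n) luk (A i j) 1.
move=> /(run_pall (P := P)) -> => [|i c' r' /run_prow_feasible ->//]; split.
  move=> h; exists (const_mx 1); split=> [j|i]; first by rewrite mxE ler01 lexx.
  have ie : i \in enum 'I_m by rewrite mem_enum.
  have [k ->] := (tnthP (in_tuple _) _ ie).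
  by under eq_bigr do rewrite mxE; exact: h.
move=> [x [x01 h]] k; apply: (le_trans (h _)).
by apply: ler_sum => j _; apply: luk_le1; case/andP: (x01 j).
Qed.

End Feasible.

(* Main.v *)
(* Every division performed by the subroutine is by |J(u)|, and J(u) is never
   empty: if u is computed from a nonempty index set J, then the sum of
   a_j + u - 1 over J equals b > 0, so that some j in J satisfies u >= 1 - a_j.
   The index sets decrease strictly along the loop, which therefore makes at
   most n rounds of O(n) operations each; the m subroutine calls together cost
   O(m n^2). *)

Require Import Defs.
From mathcomp Require Import all_boot all_order all_algebra.
From mathcomp Require Import reals.
From mathcomp Require Import zify.

Set Implicit Arguments.
Unset Strict Implicit.
Unset Printing Implicit Defensive.

Import Order.TTheory GRing.Theory Num.Theory.
Local Open Scope ring_scope.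

(** * A calculus of cost bounds for programs *)

Section RunsWithin.
Variable R : realType.

(** A total-correctness triple with a budget: since a run must exist, termination and the absence of
    division by zero are included. An upper bound instead of an exact count lets branches of
    different cost share one bound. *)
Definition runs_within T (p : prog R T) (c : nat) (Q : T -> Prop) : Prop :=
  exists d r, [/\ run p d r, (d <= c)%N & Q r].

Lemma runs_within_weaken T (p : prog R T) c c' (Q Q' : T -> Prop) :
  (c <= c')%N -> (forall r, Q r -> Q' r) ->
  runs_within p c Q -> runs_within p c' Q'.
Proof.
move=> le_cc' QQ' [d [r [pr le_dc Qr]]].
by exists d, r; split; [|exact: leq_trans le_cc'|exact: QQ'].
Qed.

Lemma runs_within_ret T (t : T) c (Q : T -> Prop) :
  Q t -> runs_within (Ret t) c Q.
Proof. by exists 0%N, t. Qed.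

Lemma runs_within_zero : runs_within Zero 0 (eq 0).
Proof. by exists 0%N, 0. Qed.

Lemma runs_within_one : runs_within One 0 (eq 1).
Proof. by exists 0%N, 1. Qed.

Lemma runs_within_arith o (x y : R) :
  arith_def o y -> runs_within (Arith o x y) 1 (eq (arith_val o x y)).
Proof. by exists 1%N, (arith_val o x y). Qed.

Lemma runs_within_cmp o (x y : R) :
  runs_within (Cmp o x y) 1 (eq (cmp_val o x y)).
Proof. by exists 1%N, (cmp_val o x y). Qed.

(** The continuation is only examined on results satisfying [Q1]; this is how facts about computed
    values reach later divisions and loops. *)
Lemma runs_within_bind S T (p : prog R S) (k : S -> prog R T) c1 c2 c Q1 Q2 :
  runs_within p c1 Q1 -> (forall s, Q1 s -> runs_within (k s) c2 Q2) ->
  (c1 + c2 <= c)%N -> runs_within (Bind p k) c Q2.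
Proof.
move=> [d1 [s [ps le1 Qs]]] /(_ s Qs)[d2 [r [kr le2 Qr]]] le_c.
exists (d1 + d2)%N, r; split=> //=; first by exists d1, d2, s.
exact: leq_trans (leq_add le1 le2) le_c.
Qed.

(** Each continuing round lowers [measure], so at most [measure s] rounds continue; the successor
    pays for the round that stops. *)
Lemma runs_within_iter S T (body : S -> prog R (S + T)) (inv : S -> Prop)
    (measure : S -> nat) (c : nat) :
  (forall s, inv s -> runs_within (body s) c (fun x =>
     if x is inl s' then inv s' /\ (measure s' < measure s)%N else True)) ->
  forall s, inv s ->
    runs_within (Iter body s) (c * (measure s).+1) (fun=> True).
Proof.
move=> bodyP s; have [k] := ubnP (measure s).
elim: k s => // k IHk s lt_sk inv_s.
have [d [[s'|r] [run_d le_dc]]] := bodyP s inv_s; last first.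
  move=> _; exists d, r; split=> //; first exact: IterStop run_d.
  by rewrite (leq_trans le_dc) // leq_pmulr.
move=> [inv_s' lt_s's].
have [d' [r [run_d' le_d' _]]] := IHk s' (leq_trans lt_s's lt_sk) inv_s'.
exists (d + d')%N, r; split=> //; first exact: IterNext run_d run_d'.
rewrite mulnS leq_add // (leq_trans le_d') // leq_mul2l.
by rewrite lt_s's orbT.
Qed.

(** * Costs of the list combinators and of the basic numerical operations *)

Lemma runs_within_psum I (f : I -> prog R R) (g : I -> R) s c :
  (forall i, runs_within (f i) c (eq (g i))) ->
  runs_within (psum f s) (c.+1 * size s) (eq (\sum_(i <- s) g i)).
Proof.
move=> fP; elim: s => [|i s IHs] /=.
  by rewrite big_nil muln0; exact: runs_within_zero.
rewrite big_cons mulnS addSn -addn1 -addnA.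
apply: runs_within_bind (fP i) _ (leqnn _) => _ <-.
apply: runs_within_bind IHs _ (leqnn _) => _ <-.
exact: runs_within_arith.
Qed.

Lemma runs_within_pall I (f : I -> prog R bool) (P : pred I) s c :
  (forall i, runs_within (f i) c (eq (P i))) ->
  runs_within (pall f s) (c * size s) (eq (all P s)).
Proof.
move=> fP; elim: s => [|i s IHs] /=.
  by rewrite muln0; exact: runs_within_ret.
rewrite mulnS -[(c * size s)%N]addn0.
apply: runs_within_bind (fP i) _ (leqnn _) => _ <-.
apply: runs_within_bind IHs _ (leqnn _) => _ <-.
exact: runs_within_ret.
Qed.

Lemma runs_within_pfilter I (f : I -> prog R bool) (P : pred I) s c :
  (forall i, runs_within (f i) c (eq (P i))) ->
  runs_within (pfilter f s) (c * size s) (eq (filter P s)).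
Proof.
move=> fP; elim: s => [|i s IHs] /=.
  by rewrite muln0; exact: runs_within_ret.
rewrite mulnS -[(c * size s)%N]addn0.
apply: runs_within_bind (fP i) _ (leqnn _) => _ <-.
apply: runs_within_bind IHs _ (leqnn _) => _ <-.
exact: runs_within_ret.
Qed.

(** An early stop only lowers the cost. The length of the result is recorded because it determines
    how many maxima are taken afterwards. *)
Lemma runs_within_pmapo I T (f : I -> prog R (option T)) s c :
  (forall i, runs_within (f i) c (fun=> True)) ->
  runs_within (pmapo f s) (c * size s)
    (fun o => if o is Some t then size t = size s else True).
Proof.
move=> fP; elim: s => [|i s IHs] /=.
  by rewrite muln0; exact: runs_within_ret.
rewrite mulnS -[(c * size s)%N]addn0.
apply: runs_within_bind (fP i) _ (leqnn _) => -[x|] _.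
  apply: runs_within_bind IHs _ (leqnn _) => o oP.
  by apply: runs_within_ret; case: o oP => //= t ->.
exact: runs_within_ret.
Qed.

Lemma runs_within_pmax (x y : R) : runs_within (pmax x y) 1 (fun=> True).
Proof.
apply: runs_within_bind (runs_within_cmp _ _ _) _ (leqnn _) => z _.
exact: runs_within_ret.
Qed.

Lemma runs_within_pmaxs (x : R) s :
  runs_within (pmaxs x s) (size s) (fun=> True).
Proof.
elim: s x => [|y s IHs] x /=; first exact: runs_within_ret.
by apply: runs_within_bind (runs_within_pmax x y) _ (leqnn _) => z _; exact: IHs.
Qed.

Lemma runs_within_pluk (a x : R) :
  runs_within (pluk a x) 3 (eq (luk a x)).
Proof.
apply: runs_within_bind (@runs_within_arith OpAdd a x isT) _ (leqnn _) => _ <-.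
apply: runs_within_bind runs_within_one _ (leqnn _) => _ <-.
apply: runs_within_bind (@runs_within_arith OpSub _ 1 isT) _ (leqnn _) => _ <-.
apply: runs_within_bind runs_within_zero _ (leqnn _) => _ <-.
apply: runs_within_bind (runs_within_cmp _ _ _) _ (leqnn _) => _ <-.
by apply: runs_within_ret; rewrite /luk /=; case: leP.
Qed.

(** * Cost of the subroutine for a single constraint *)

Section Row.
Variables (n : nat) (a : 'I_n -> R) (b : R).

Lemma runs_within_psumluk (J : {set 'I_n}) u :
  runs_within (psumluk a J u) (4 * n) (eq (\sum_(j <- enum J) luk (a j) u)).
Proof.
(* Each index costs three operations for [pluk] and one addition, and [J] has at most [n]
   indices. *)
apply: (runs_within_weaken _ _
  (runs_within_psum (enum J) (fun j => runs_within_pluk (a j) u))) => //.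
by rewrite leq_mul2l -cardE -[leqRHS]card_ord max_card.
Qed.

Lemma runs_within_prow_feasible :
  runs_within (prow_feasible a b) (4 * n).+1
    (eq (b <= \sum_(j <- enum [set: 'I_n]) luk (a j) 1)).
Proof.
rewrite -addn1.
apply: runs_within_bind runs_within_one _ (leqnn _) => _ <-.
apply: runs_within_bind (runs_within_psumluk _ _) _ (leqnn _) => _ <-.
exact: runs_within_cmp.
Qed.

(** The index set $J(\mathbf u)$ of the subroutine. *)
Definition active (u : R) : {set 'I_n} := [set j | 1 - a j <= u].

Lemma runs_within_pJ u : runs_within (pJ a u) (2 * n) (eq (active u)).
Proof.
have test j : runs_within (let* one := One in
    let* t := Arith OpSub one (a j) in Cmp CmpLe t u) 2 (eq (1 - a j <= u)).
  apply: runs_within_bind runs_within_one _ (leqnn _) => _ <-.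
  apply: runs_within_bind (@runs_within_arith OpSub _ _ isT) _ (leqnn _).
  by move=> _ <-; exact: runs_within_cmp.
have -> : (2 * n = 2 * size (enum 'I_n) + 0)%N by rewrite addn0 size_enum_ord.
apply: runs_within_bind (runs_within_pfilter _ test) _ (leqnn _) => _ <-.
apply: runs_within_ret.
by apply/setP => j; rewrite !inE mem_filter mem_enum andbT.
Qed.

Definition next (J : {set 'I_n}) : R := (b - \sum_(j in J) a j) / #|J|%:R + 1.

(** Nonemptiness of [J] makes the division legal. Summing and counting cost at most [n] each; a
    subtraction, a division and an addition remain. *)
Lemma runs_within_pnext (J : {set 'I_n}) : J != set0 ->
  runs_within (pnext a b J) (2 * n + 3) (eq (next J)).
Proof.
move=> J0; have le_Jn : (#|J| <= n)%N by rewrite -[leqRHS]card_ord max_card.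
have card_neq0 : #|J|%:R != 0 :> R by rewrite pnatr_eq0 cards_eq0.
have sum_a : runs_within (psum (fun j => Ret (a j)) (enum J)) n
    (eq (\sum_(j in J) a j)).
  rewrite -big_enum; apply: runs_within_weaken
    (runs_within_psum _ (fun j => runs_within_ret 0 (erefl (a j)))) => //.
  by rewrite mul1n -cardE.
have count : runs_within (psum (fun=> One) (enum J)) n (eq (#|J|%:R : R)).
  rewrite -sum1_card natr_sum -big_enum; apply: runs_within_weaken
    (runs_within_psum _ (fun=> runs_within_one)) => //.
  by rewrite mul1n -cardE.
have -> : (2 * n + 3 = n + (1 + (n + 2)))%N by lia.
apply: runs_within_bind sum_a _ (leqnn _) => _ <-.
apply: runs_within_bind (@runs_within_arith OpSub _ _ isT) _ (leqnn _) => _ <-.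
apply: runs_within_bind count _ (leqnn _) => _ <-.
apply: runs_within_bind (@runs_within_arith OpDiv _ _ card_neq0) _ (leqnn _).
move=> _ <-; apply: runs_within_bind runs_within_one _ (leqnn _) => _ <-.
exact: runs_within_arith.
Qed.

(** This makes nonemptiness an invariant of the loop. *)
Lemma active_next_neq0 (J : {set 'I_n}) : 0 < b -> J != set0 ->
  active (next J) != set0.
Proof.
move=> b0 J0; have card_neq0 : #|J|%:R != 0 :> R by rewrite pnatr_eq0 cards_eq0.
apply: contraTneq b0 => active0; rewrite -leNgt.
(* [next J] is the solution [u] of the linear equation $\sum_{j\in J}(a_j-1+u)=b$. If no index were
   active, every summand would be negative, forcing [b <= 0]. *)
suff -> : b = \sum_(j in J) (a j - 1 + next J).
  apply: sumr_le0 => j _; have := in_set0 j; rewrite -active0 inE => /negbT.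
  by rewrite -ltNge -subr_gt0 => /ltW; rewrite -oppr_le0 opprB addrC opprB.
rewrite !big_split /= !sumr_const mulNrn.
rewrite -[(_ / _) *+ _]mulr_natr divfK // -addrA [X in _ + X]addrC addrK addrC.
by rewrite subrK.
Qed.

Lemma runs_within_psubset (J K : {set 'I_n}) :
  runs_within (psubset R J K) n (eq (J \subset K)).
Proof.
(* On 0/1 indicators, [<=] is implication between memberships. *)
have test j : runs_within (let* x := pindic R J j in
    let* y := pindic R K j in Cmp CmpLe x y) 1 (eq ((j \in J) ==> (j \in K))).
  have indic (L : {set 'I_n}) :
      runs_within (pindic R L j) 0 (eq (j \in L)%:R).
    rewrite /pindic; case: (j \in L).
      exact: runs_within_one.
    exact: runs_within_zero.
  apply: runs_within_bind (indic J) _ (leqnn _) => _ <-.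
  apply: runs_within_bind (indic K) _ (leqnn _) => _ <-.
  apply: runs_within_weaken (runs_within_cmp _ _ _) => // _ <- /=.
  by rewrite ler_nat; case: (j \in J); case: (j \in K).
apply: runs_within_weaken (runs_within_pall _ test) => [|_ <-].
  by rewrite mul1n size_enum_ord.
apply/subsetP/allP => [h j _|h j jJ]; first by apply/implyP; exact: h.
by apply: (implyP (h j _)); rewrite ?mem_enum.
Qed.

Lemma runs_within_pproper (J K : {set 'I_n}) :
  runs_within (pproper R J K) (2 * n) (eq (J \proper K)).
Proof.
have -> : (2 * n = n + (n + 0))%N by lia.
apply: runs_within_bind (runs_within_psubset J K) _ (leqnn _) => _ <-.
apply: runs_within_bind (runs_within_psubset K J) _ (leqnn _) => _ <-.
exact: runs_within_ret.
Qed.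

Lemma runs_within_subroutine : (0 < n)%N -> 0 < b ->
  runs_within (subroutine a b) (35 * n ^ 2) (fun=> True).
Proof.
move=> n0 b0.
have le_n (J : {set 'I_n}) : (#|J| <= n)%N by rewrite -[leqRHS]card_ord max_card.
have setT0 : [set: 'I_n] != set0 by rewrite -card_gt0 cardsT card_ord.
(* The stages add up to $6n^2+21n+8$, which is at most $35n^2$ because $n\ge 1$. *)
apply: (@runs_within_weaken _ _
  ((4 * n).+1 + ((2 * n + 3) + (2 * n + (4 * n + (1 + ((6 * n + 3) * n.+1 + 0))))))
  _ (fun=> True)) => //; first by nia.
apply: runs_within_bind runs_within_prow_feasible _ (leqnn _) => ok _.
case: ok; last exact: runs_within_ret.
apply: runs_within_bind (runs_within_pnext setT0) _ (leqnn _) => _ <-.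
apply: runs_within_bind (runs_within_pJ _) _ (leqnn _) => _ <-.
apply: runs_within_bind (runs_within_psumluk _ _) _ (leqnn _) => s _.
apply: runs_within_bind (runs_within_cmp _ _ _) _ (leqnn _) => -[] _.
  exact: runs_within_ret.
apply: (@runs_within_bind _ _ _ _ _ _ _ (fun=> True)) (leqnn _); last first.
  by move=> u _; exact: runs_within_ret.
(* The starting value is [next] of the full index set, so the invariant already holds on entry to
   the loop. *)
have J0 := active_next_neq0 b0 setT0.
(* The measure is the cardinality, at most [n], which gives the factor [n.+1]. A round costs
   [2 * n + 3] for the new value and [2 * n] each for the index set and the strict inclusion
   test. *)
apply: runs_within_weaken (@runs_within_iter _ _ _
  (fun J : {set 'I_n} => J != set0) (fun J => #|J|) (6 * n + 3) _ _ J0) => //.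
  by rewrite leq_mul2l ltnS le_n orbT.
move=> J Jneq0; have -> : (6 * n + 3 = (2 * n + 3) + (2 * n + (2 * n + 0)))%N by lia.
apply: runs_within_bind (runs_within_pnext Jneq0) _ (leqnn _) => _ <-.
apply: runs_within_bind (runs_within_pJ _) _ (leqnn _) => _ <-.
apply: runs_within_bind (runs_within_pproper _ _) _ (leqnn _) => _ <-.
apply: runs_within_ret; case: ifP => // /proper_card lt_card.
by split=> //; exact: active_next_neq0.
Qed.

End Row.

(** * Cost of the whole algorithm *)

Lemma runs_within_algorithm m n (A : 'M[R]_(m, n)) (b : 'rV[R]_m) :
  (0 < n)%N -> (forall i, 0 < b ord0 i) ->
  runs_within (algorithm A b) (41 * (m * n ^ 2)) (fun=> True).
Proof.
move=> n0 b0.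
(* Emptiness test, subroutine calls and maxima add up to $m(35n^2+4n+2)$, at most $41mn^2$ because
   $n\ge 1$. *)
apply: (@runs_within_weaken _ _
  ((4 * n).+1 * m + ((35 * n ^ 2) * m + (m + 0))) _ (fun=> True)) => //.
  by nia.
have feas := runs_within_pall (enum 'I_m)
  (fun i => runs_within_prow_feasible (A i) (b ord0 i)).
rewrite size_enum_ord in feas.
apply: runs_within_bind feas _ (leqnn _) => ok _; case: ok; last exact: runs_within_ret.
have rows := runs_within_pmapo (enum 'I_m)
  (fun i => runs_within_subroutine (A i) n0 (b0 i)).
rewrite size_enum_ord in rows.
apply: runs_within_bind rows _ (leqnn _) => -[[|u us]|] /= szE;
  try exact: runs_within_ret.
(* Here [us] has $m-1$ entries, so the maxima fit in the budget [m]. *)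
apply: (runs_within_bind (runs_within_pmaxs u us) (c2 := 0%N)) => [v _|].
  exact: runs_within_ret.
by rewrite leq_add2r -szE.
Qed.

End RunsWithin.

Theorem theorem5p8 (R : realType) :
  exists C : nat,
    forall (m n : nat) (A : 'M[R]_(m, n)) (b : 'rV[R]_m),
      (0 < m)%N -> (0 < n)%N ->
      (forall i j, 0 <= A i j <= 1) ->
      (forall i, 0 < b ord0 i) ->
      exists (c : nat) (out : option 'rV[R]_n),
        run (algorithm A b) c out /\ (c <= C * maxn m n ^ 3)%N.
Proof.
exists 41%N => m n A b _ n0 _ b0.
have [c [out [run_c le_c _]]] := runs_within_algorithm A n0 b0.
exists c, out; split=> //; apply: leq_trans le_c _.
(* One factor of the cube bounds $m$, the remaining square bounds $n^2$. *)
rewrite leq_mul2l (expnS _ 2) leq_mul ?leq_maxl ?orbT //.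
by rewrite leq_exp2r ?leq_maxr.
Qed.
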